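(* Let $X$ and $Y$ be metric spaces, and suppose that $X$ is an absolute Souslin-$\mathscr{F}$ set. Then a function $f\colon X \to Y$ is a $\mathbf{\Delta}^0_2$-function if and only if it is piecewise continuous.
   Context: $\mathbf{\Sigma}^0_2$ sets in a metric space are countable unions of closed sets ($F_\sigma$ sets); $\mathbf{\Delta}^0_2$ sets are those that are both $F_\sigma$ and $G_\delta$. A function $f\colon X\to Y$ is a $\mathbf{\Delta}^0_2$-function if $f^{-1}(S)$ is $\mathbf{\Sigma}^0_2$ in $X$ for every $\mathbf{\Sigma}^0_2$ set $S\subseteq Y$ (equivalently, $f^{-1}(U)$ is $\mathbf{\Delta}^0_2$ for every open $U\subseteq Y$). A function $f\colon X\to Y$ is piecewise continuous if $X$ is the union of an increasing sequence $X_0\subseteq X_1\subseteq\dotsb$ of closed subsets of $X$ such that $f|_{X_n}$ is continuous for every $n$. A subset of a metric space is a Souslin-$\mathscr{F}$ set if it is obtained by applying the Souslin operation $\mathcal{A}$ to a family of closed sets, i.e. it is of the form $\bigcup_{x\in{}^\omega\omega}\bigcap_{n\in\omega} F_{x|n}$ where each $F_s$ ($s$ a finite sequence of natural numbers) is closed. A metric space $X$ is an absolute Souslin-$\mathscr{F}$ set if $X$ is a Souslin-$\mathscr{F}$ subset of the completion of $X$ with respect to its metric. *)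

(* Defs.v *)
From mathcomp Require Import all_boot all_order all_algebra.
From mathcomp Require Import boolp classical_sets functions reals topology.
From mathcomp Require Import borel_hierarchy.

Set Implicit Arguments.
Unset Strict Implicit.
Unset Printing Implicit Defensive.

Local Open Scope classical_set_scope.
Local Open Scope ring_scope.

(* [Fsigma] is the class Sigma^0_2. *)
Definition Delta02_function (X Y : topologicalType) (f : X -> Y) : Prop :=
  forall S : set Y, Fsigma S -> Fsigma (f @^-1` S).

Definition piecewise_continuous (X Y : topologicalType) (f : X -> Y) : Prop :=
  exists A : nat -> set X,
    [/\ forall n, closed (A n),
        forall n, A n `<=` A n.+1,
        \bigcup_n A n = [set: X]
      & forall n, {within A n, continuous f}].

(* [mkseq x n] is the restriction x|n = [:: x 0; ...; x n.-1]. *)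
Definition Souslin_operation (T : Type) (F : seq nat -> set T) : set T :=
  \bigcup_(x in [set: nat -> nat]) \bigcap_n F (mkseq x n).

Definition Souslin_closed (T : topologicalType) (S : set T) : Prop :=
  exists2 F : seq nat -> set T,
    (forall s, closed (F s)) & S = Souslin_operation F.

(* The axiom of [completeType], which cannot be used here since it only covers
   pointed, hence nonempty, spaces. *)
Definition complete_space (T : uniformType) : Prop :=
  forall F : set_system T, ProperFilter F -> cauchy F -> exists l : T, F --> l.

Definition is_completion (R : realType) (X Z : metricType R) (i : X -> Z) :
    Prop :=
  [/\ complete_space Z,
      forall x y : X, mdist (i x) (i y) = mdist x y
    & dense (range i)].

(* A completion is unique up to a unique isometry over X, and Souslin-F sets are
   preserved by isometries, so it does not matter which completion is used. *)
Definition absolute_Souslin (R : realType) (X : metricType R) : Prop :=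
  exists (Z : metricType R) (i : X -> Z),
    is_completion i /\ Souslin_closed (range i).

(* Main.v *)
Require Import Defs.
From mathcomp Require Import all_boot all_order all_algebra.
From mathcomp Require Import boolp classical_sets functions reals topology.
From mathcomp Require Import interval_inference normedtype borel_hierarchy.
From mathcomp Require wochoice.

Set Implicit Arguments.
Unset Strict Implicit.
Unset Printing Implicit Defensive.

Import Order.TTheory GRing.Theory Num.Theory.

Local Open Scope classical_set_scope.
Local Open Scope ring_scope.

(** Call a subset of [X] small if it is covered by countably many closed sets on
    each of which [f] is continuous. Small sets form a sigma-ideal, and a set
    that is locally small is small. Suppose that [f] is a Delta^0_2-function
    but [X] is not small. One builds points [x_n], arranged in a tree in which
    every node has infinitely many successors converging to it, together with
    disjoint closed neighbourhoods [B_n] of [f x_n] (the obstacles), such that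
    everything below node [n] lies in a closed set whose image misses all
    earlier obstacles: since the complement of the obstacles is open, its
    preimage is F_sigma, and one of its closed pieces is again not small.
    Following a Souslin scheme of [X] along the tree makes every infinite
    branch converge in [X], to a point whose image misses the union [U] of the
    interiors of the obstacles. The preimage of the complement of [U] is a union
    of closed sets [D_j], none of which contains any [x_n]; hence some branch
    successively avoids each [D_j], and its limit lies neither in the preimage
    of [U] nor in that of its complement. *)

(** * Preliminaries on [Fsigma] sets and restricted continuity *)

Lemma exists_natSinv_lt (R : realType) (e : R) :
  0 < e -> exists n, n.+1%:R^-1 < e.
Proof.
move=> e0.
have [N _ /(_ N (leqnn N))] := near_infty_natSinv_lt (PosNum e0).
by exists N.
Qed.

Lemma ge_natSinv (R : realType) m n :
  (m <= n)%N -> n.+1%:R^-1 <= m.+1%:R^-1 :> R.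
Proof. by move=> mn; rewrite lef_pV2 ?posrE ?ltr0Sn// ler_nat ltnS. Qed.

Lemma Fsigma_bigcup (T : topologicalType) (S : nat -> set T) :
  (forall n, Fsigma (S n)) -> Fsigma (\bigcup_n S n).
Proof.
move=> FS.
have /choice[F FP] n : exists F : nat -> set T,
    (forall i, closed (F i)) /\ S n = \bigcup_i F i.
  by have [F] := FS n; exists F.
pose G k := if unpickle k is Some (n, m) then F n m else set0.
exists G.
  move=> k; rewrite /G; case: (unpickle k) => [[n m]|]; last exact: closed0.
  by have [] := FP n.
apply/seteqP; split => [x [n _ Snx]|x [k _]].
  have [_ E] := FP n; rewrite E in Snx; have [m _ Fx] := Snx.
  by exists (pickle (n, m)) => //; rewrite /G pickleK.
rewrite /G; case: (unpickle k) => [[n m]|//] Fx.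
by exists n => //; have [_ ->] := FP n; exists m.
Qed.

Lemma closed_ball_interior (R : realType) (T : metricType R) (V : set T)
    (r : R) :
  closed [set x | ball x r `<=` V].
Proof.
move=> x clx y; rewrite ballEmdist /= => xy.
have e0 : 0 < r - mdist x y by rewrite subr_gt0.
have [z [zV]] := clx _ (nbhsx_ballx x _ e0).
rewrite ballEmdist /= => xz; apply: zV; rewrite ballEmdist /=.
apply: le_lt_trans (metric_triangle z x y) _.
by rewrite metric_sym -ltrBrDr.
Qed.

Lemma open_Fsigma (R : realType) (T : metricType R) (O : set T) :
  open O -> Fsigma O.
Proof.
move=> oO; exists (fun n => [set x | ball x n.+1%:R^-1 `<=` O]).
  by move=> n; exact: closed_ball_interior.
apply/seteqP; split => [x Ox|x [n _]]; last first.
  by apply; apply: ballxx; rewrite invr_gt0 ltr0Sn.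
have /nbhs_ballP[e /= e0 eO] : nbhs x O by exact: open_nbhs_nbhs.
have [n ne] := exists_natSinv_lt e0.
by exists n => // y /= yx; apply: eO; apply: le_ball yx; exact: ltW.
Qed.

Lemma closed_nbhs_sub (T : uniformType) (y : T) (O : set T) : nbhs y O ->
  exists B, [/\ closed B, nbhs y B & B `<=` O].
Proof.
move=> /uniform_regular[B yB BO]; exists (closure B); split => //.
  exact: closed_closure.
by apply: filterS yB; exact: subset_closure.
Qed.

Lemma within_continuousP (X Y : topologicalType) (f : X -> Y) (A : set X) :
  {within A, continuous f} <->
  forall x O, A x -> nbhs (f x) O ->
    exists2 V, nbhs x V & V `&` A `<=` f @^-1` O.
Proof.
split=> [/subspace_continuousP cf x O Ax /(cf x Ax) h|h].
  by exists (fun z => A z -> O (f z)) => // z [Vz /Vz].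
apply/subspace_continuousP => x Ax O /(h x O Ax)[V xV VO].
by rewrite nbhs_simpl /= /within /=; apply: filterS xV => z Vz Az; exact: VO.
Qed.

Lemma closed_preimage_within (X Y : topologicalType) (f : X -> Y) (A : set X)
    (B : set Y) :
  closed A -> {within A, continuous f} -> closed B -> closed (A `&` f @^-1` B).
Proof.
move=> cA cf cB x clx.
have Ax : A x by apply: cA; apply: closureS clx; exact: subIsetl.
split => //; apply: cB => O fxO.
have [V xV VO] := (within_continuousP f A).1 cf _ _ Ax fxO.
have [z [[Az Bz] Vz]] := clx _ xV.
by exists (f z); split => //; apply: VO.
Qed.

Lemma piecewise_continuous_Delta02 (X Y : topologicalType) (f : X -> Y) :
  piecewise_continuous f -> Delta02_function f.
Proof.
move=> [A [cA _ AT fA]] S [F cF ->].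
have -> : f @^-1` (\bigcup_i F i) =
    \bigcup_n \bigcup_k (A n `&` f @^-1` F k).
  apply/seteqP; split => [x [k _ Fx]|x [n _ [k _ [_ Fx]]]]; last by exists k.
  have [n _ Ax] : (\bigcup_n A n) x by rewrite AT.
  by exists n => //; exists k.
apply: Fsigma_bigcup => n; apply: Fsigma_bigcup => k.
by apply: closed_Fsigma; exact: closed_preimage_within.
Qed.

(* The pieces are closed in [X], not just in [P]: this makes the notion
   hereditary. *)
Definition sigma_continuous_on (X Y : topologicalType) (f : X -> Y)
    (P : set X) : Prop :=
  exists C : nat -> set X,
    [/\ forall n, closed (C n), forall n, {within C n, continuous f}
      & P `<=` \bigcup_n C n].

(** * The sigma-ideal of small sets *)

Section sigma_ideal.
Context (X Y : topologicalType) (f : X -> Y).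
Local Notation small := (sigma_continuous_on f).

Lemma small_sub P Q : P `<=` Q -> small Q -> small P.
Proof.
by move=> PQ [C [cC fC QC]]; exists C; split => //; exact: subset_trans QC.
Qed.

Lemma small_closed C : closed C -> {within C, continuous f} -> small C.
Proof. by move=> cC fC; exists (fun=> C); split => // x Cx; exists 0%N. Qed.

Lemma small0 : small set0.
Proof.
apply: small_closed; first exact: closed0.
by apply/within_continuousP.
Qed.

Lemma small_bigcup (P : nat -> set X) :
  (forall n, small (P n)) -> small (\bigcup_n P n).
Proof.
move=> sP; have [C CP] := choice sP.
exists (fun k => if unpickle k is Some (n, m) then C n m else set0); split.
- move=> k; case: (unpickle k) => [[n m]|]; last exact: closed0.
  by have [] := CP n.
- move=> k; case: (unpickle k) => [[n m]|]; last exact/within_continuousP.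
  by have [] := CP n.
- move=> x [n _ Px]; have [_ _ /(_ x Px)[m _ Cx]] := CP n.
  by exists (pickle (n, m)) => //; rewrite pickleK.
Qed.

Lemma smallU P Q : small P -> small Q -> small (P `|` Q).
Proof.
move=> sP sQ.
apply: (@small_sub _ (\bigcup_n (if n is 0 then P else Q))); last first.
  by apply: small_bigcup => -[].
by move=> x [Px|Qx]; [exists 0%N|exists 1%N].
Qed.

(** Partial unions make the pieces increasing; continuity survives because finitely many closed sets
    are glued. *)
Lemma piecewise_continuous_small : small setT -> piecewise_continuous f.
Proof.
move=> [C [cC fC CT]].
pose A n := \big[setU/set0]_(i < n.+1) C i.
have AS n : A n.+1 = A n `|` C n.+1 by rewrite /A big_ord_recr.
have AP n : closed (A n) /\ {within A n, continuous f}.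
  elim: n => [|n [cA fA]]; first by rewrite /A big_ord1.
  by rewrite AS; split; [exact: closedU|exact: withinU_continuous].
exists A; split=> [n|n||n]; [by have [] := AP n| | |by have [] := AP n].
- by rewrite AS; exact: subsetUl.
- rewrite -subTset => x /CT[n _ Cx]; exists n => //.
  by rewrite /A big_ord_recr /=; right.
Qed.

End sigma_ideal.

(** * Well-orderings and locally small sets *)

Lemma exists_well_order (T : eqType) : exists le : T -> T -> Prop,
  (forall i j, le i j -> le j i -> i = j) /\
  (forall A : set T, A !=set0 -> exists i, A i /\ forall j, A j -> le i j).
Proof.
have [le le_wo] := wochoice.well_ordering_principle T.
have lemin (A : set T) : A !=set0 ->
    exists2 i, A i /\ (forall j, A j -> le i j) &
      forall k, A k -> (forall j, A j -> le k j) -> i = k.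
  move=> [x Ax]; have [|i [[Ai imin] iu]] := le_wo (fun i => `[< A i >]).
    by exists x; exact/asboolP.
  exists i; first by split=> [|j Aj]; [exact/asboolP|apply/imin/asboolP].
  move=> k Ak kmin; apply: iu; split=> [|j /asboolP]; last exact: kmin.
  exact/asboolP.
exists (fun i j => le i j); split=> [i j ij ji|A /lemin[i]]; last by exists i.
(* Unique least elements of singletons give reflexivity, those of pairs antisymmetry. *)
have refl k : le k k.
  by have [|l [-> +] _] := lemin [set k]; [exists k|exact].
have [|l _ lu] := lemin [set i; j]; first by exists i; left.
transitivity l; [apply/esym|]; apply: lu; rewrite /=; auto.
  by move=> k [] ->.
by move=> k [] ->.
Qed.

Section small_local.
Context (R : realType) (X : metricType R) (Y : topologicalType) (f : X -> Y).
Local Notation small := (sigma_continuous_on f).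

(** Points of the union within [r / 2] of a common point lie in the same [Q i], so closedness and
    continuity are inherited locally. *)
Lemma separated_bigcup (I : Type) (Q : I -> set X) (r : R) : 0 < r ->
  (forall i, closed (Q i)) -> (forall i, {within Q i, continuous f}) ->
  (forall i j x y, Q i x -> Q j y -> ball x r y -> i = j) ->
  closed (\bigcup_i Q i) /\ {within \bigcup_i Q i, continuous f}.
Proof.
move=> r0 cQ fQ sepQ.
have r20 : 0 < r / 2 by rewrite divr_gt0.
have near1 i x y z : ball x (r / 2) y -> ball x (r / 2) z -> Q i y ->
    (\bigcup_i Q i) z -> Q i z.
  move=> xy xz Qy [j _ Qz]; suff <- : j = i by [].
  apply: (sepQ _ _ z y) => //; rewrite (splitr r).
  by apply: ball_triangle xy; exact: ball_sym.
split=> [x clx|].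
  have [y [[i _ Qy] xy]] := clx _ (nbhsx_ballx x _ r20).
  exists i => //; apply: cQ => V xV.
  have [z [Qz [Vz xz]]] := clx _ (filterI xV (nbhsx_ballx x _ r20)).
  by exists z; split => //; exact: near1 xy xz Qy Qz.
apply/within_continuousP => x O [i _ Qx] fxO.
have [V xV VO] := (within_continuousP _ _).1 (fQ i) _ _ Qx fxO.
exists (V `&` ball x (r / 2)); first exact: filterI (nbhsx_ballx x _ r20).
move=> z [[Vz xz] Qz]; apply: VO; split => //.
by apply: near1 xz Qx Qz; exact: ballxx.
Qed.

(* Well-order [X]. The points lying [n.+1%:R^-1]-deep in the neighbourhood
   [V i] and in no earlier [V j] form, for fixed [n], a uniformly separated
   family of closed sets; together these families cover [P]. *)
Lemma small_local (P : set X) :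
  (forall x, P x -> exists2 V, nbhs x V & small (V `&` P)) -> small P.
Proof.
move=> locP.
have /choice[V VP] x : exists V, [/\ open V, P x -> V x & small (V `&` P)].
  have [Px|nPx] := pselect (P x).
    have [V xV sV] := locP x Px; exists V°.
    split => //; first exact: open_interior.
    by apply: small_sub sV; apply: setSI; exact: interior_subset.
  by exists set0; split => //; [exact: open0|rewrite set0I; exact: small0].
have [le [le_anti le_min]] := exists_well_order X.
have /choice[m mP] x : exists i, P x -> V i x /\ forall j, V j x -> le i j.
  have [Px|nPx] := pselect (P x); last by exists x.
  have [|i [Vi imin]] := le_min [set i | V i x].
    by exists x; have [_ Vx _] := VP x; exact: Vx.
  by exists i.
pose r n : R := n.+1%:R^-1.
pose E n i := [set x | ball x (r n) `<=` V i] `&`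
              [set x | forall j, V j x -> le i j].
have r0 n : 0 < r n by rewrite invr_gt0 ltr0Sn.
have cE n i : closed (E n i).
  apply: closedI; first exact: closed_ball_interior.
  move=> x clx j Vjx; have [oV _ _] := VP j.
  by have [y [+ Vjy]] := clx _ (open_nbhs_nbhs (conj oV Vjx)); exact.
(* Each of two points closer than [r n] lies in the other's neighbourhood, so minimality applies in
   both directions. *)
have sepE n i j x y : E n i x -> E n j y -> ball x (r n) y -> i = j.
  move=> [ix xi] [jy yj] xy; apply: le_anti.
    by apply: xi; apply: jy; exact: ball_sym.
  by apply: yj; apply: ix.
have /choice[C CP] i : small (V i `&` P) by have [] := VP i.
pose Q n k i := C i k `&` E n i.
have QP n k :
    closed (\bigcup_i Q n k i) /\ {within \bigcup_i Q n k i, continuous f}.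
  apply: (@separated_bigcup _ _ (r n)) => // [i|i|i j x y [_ ?] [_ ?]];
    last exact: sepE.
    by apply: closedI => //; have [] := CP i.
  apply/within_continuousP => x O [Cx _] fxO.
  have [_ /(_ k)/within_continuousP fC _] := CP i.
  have [W xW WO] := fC _ _ Cx fxO.
  by exists W => // z [Wz [Cz _]]; apply: WO.
apply: (@small_sub _ _ _ _ (\bigcup_n \bigcup_k \bigcup_i Q n k i)); last first.
  apply: small_bigcup => n; apply: small_bigcup => k.
  by have [? ?] := QP n k; exact: small_closed.
move=> x Px; have [Vx xmin] := mP x Px.
have [oV _ _] := VP (m x).
have /nbhs_ballP[e /= e0 eV] := open_nbhs_nbhs (conj oV Vx).
have [n ne] := exists_natSinv_lt e0.
have [_ _ /(_ x (conj Vx Px))[k _ Cx]] := CP (m x).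
exists n => //; exists k => //; exists (m x) => //.
split => //; split => // y xy.
by apply: eV; apply: le_ball xy; exact: ltW.
Qed.

End small_local.

(** * Irreducible points and one-step extensions of the tree *)

Section irreducible.
Context (R : realType) (X Y : metricType R) (f : X -> Y).
Hypothesis Df : Delta02_function f.
Local Notation small := (sigma_continuous_on f).

(** Arbitrarily near [x], the set [W] keeps room for further nodes once the obstacles [A] are
    placed. *)
Definition irreducible (W : set X) (x : X) (A : set Y) : Prop :=
  forall V, nbhs x V -> ~ small (V `&` W `\` f @^-1` A).

Lemma irreducible_sub W x A B :
  A `<=` B -> irreducible W x B -> irreducible W x A.
Proof.
move=> AB irr V xV sV; apply: (irr V xV); apply: small_sub sV.
by apply: setDS => z; exact: AB.
Qed.

Lemma irreducible_closure W x A : irreducible W x A -> closure W x.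
Proof.
move=> irr V xV; apply: contrapT => nWV; apply: (irr V xV).
suff -> : V `&` W `\` f @^-1` A = set0 by exact: small0.
by rewrite -subset0 => z [[Vz Wz] _]; apply: nWV; exists z.
Qed.

Variable Xs : seq nat -> set X.
Hypothesis XsS : forall s, Xs s `<=` \bigcup_k Xs (rcons s k).

(* [domain] is the set in which all later nodes below this one lie; it is
   contained in [Xs code] and has [apex] in its closure, though [apex] need not
   belong to it. [obstacle] is a closed neighbourhood of [f apex]. *)
Record node := Node {
  apex : X; domain : set X; code : seq nat; obstacle : set Y }.

(** In use, [W] is the set offered by the parent, [A] the union of the earlier obstacles and [s] the
    parent's code. [ext_avoid] concerns a closure because the limit of a branch is only known to lie
    in closures of domains. *)
Record extension_of (W : set X) (A : set Y) (s : seq nat) (v : node) : Prop := {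
  ext_domain : domain v `<=` W;
  ext_code : exists k, code v = rcons s k;
  ext_Souslin : domain v `<=` Xs (code v);
  ext_closed : closed (obstacle v);
  ext_nbhs : nbhs (f (apex v)) (obstacle v);
  ext_disjoint : obstacle v `<=` ~` A;
  ext_avoid : closure (domain v) `<=` f @^-1` (~` A);
  ext_irreducible : irreducible (domain v) (apex v) (A `|` obstacle v) }.

(** A Cantor-Bendixson argument: the points of [W] near which [W] is small form a small set by
    [small_local], so they can be discarded. *)
Lemma nonsmall_kernel (W : set X) : ~ small W ->
  exists W', [/\ W' `<=` W, ~ small W' &
    forall x V, closure W' x -> nbhs x V -> ~ small (V `&` W')].
Proof.
move=> nW.
pose K := [set x | W x /\ forall V, nbhs x V -> ~ small (V `&` W)].
have sWK : small (W `\` K).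
  apply: small_local => x [Wx nKx].
  have [V] : exists V, ~ (nbhs x V -> ~ small (V `&` W)).
    by apply/existsNP => h; apply: nKx.
  move=> /not_implyP[xV /contrapT sV]; exists V => //.
  by apply: small_sub sV; apply: setIS; exact: subDsetl.
exists K; split=> [x []//|sK|x V clx xV sV].
  apply: nW; apply: (small_sub _ (smallU sK sWK)) => x Wx.
  by have [Kx|nKx] := pselect (K x); [left|right].
have [z [[Wz zK] zV]] := clx _ (nbhs_interior xV).
apply: (zK V° (open_nbhs_nbhs (conj (open_interior V) zV))).
apply: (small_sub _ (smallU sV sWK)) => y [yV Wy].
have [Ky|nKy] := pselect (K y); last by right.
by left; split => //; exact: interior_subset.
Qed.

(* Pick a discontinuity point [x] of [f] on the closure of the kernel. If [x]
   fails with the obstacle [B], then near [x] almost everything is mapped into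
   [B], and a nearby point mapped away from [B] works instead. *)
Lemma exists_extension (W : set X) (A : set Y) (s : seq nat) :
  closed A -> W `<=` Xs s -> ~ small (W `\` f @^-1` A) ->
  exists v, extension_of W A s v.
Proof.
move=> cA WXs nW.
have [C cC CE] : Fsigma (f @^-1` (~` A)).
  by apply: Df; apply: open_Fsigma; exact: closed_openC.
have [j [k nW1]] : exists j k, ~ small (W `&` C j `&` Xs (rcons s k)).
  apply: contrapT => h; apply: nW.
  apply: (@small_sub _ _ _ _
    (\bigcup_j \bigcup_k (W `&` C j `&` Xs (rcons s k)))); last first.
    apply: small_bigcup => j; apply: small_bigcup => k.
    by apply: contrapT => njk; apply: h; exists j, k.
  move=> x [Wx nAx].
  have [j _ Cx] : (\bigcup_j C j) x by rewrite -CE.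
  have [k _ Xx] := XsS (WXs _ Wx).
  by exists j => //; exists k.
have [W' [W'W nW' kerW']] := nonsmall_kernel nW1.
(* Cutting down to the closed piece [C j] makes even the closure of [W'] avoid [A]. *)
have clC : closure W' `<=` C j.
  move=> x clx; apply: (cC j); apply: closureS clx.
  by move=> z /W'W[[]].
have clA : closure W' `<=` f @^-1` (~` A).
  by move=> x /clC Cx; rewrite CE; exists j.
suff [x [B [clx cB xB irr]]] : exists x B, [/\ closure W' x, closed B,
    nbhs (f x) B & irreducible W' x B].
  have [B' [cB' xB' B'A]] : exists B', [/\ closed B', nbhs (f x) B' &
      B' `<=` ~` A].
    apply: closed_nbhs_sub; apply: open_nbhs_nbhs; split; last exact: clA.
    exact: closed_openC.
  exists (Node x W' (rcons s k) (B `&` B')); split => //=.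
  - by move=> z /W'W[[]].
  - by exists k.
  - by move=> z /W'W[].
  - exact: closedI.
  - exact: filterI.
  - by move=> z [_ /B'A].
  - move=> V xV sV; apply: (irr V xV); apply: small_sub sV => z [[Vz Wz] Bz].
    split => // -[Az|[]//].
    exact: (clA z (subset_closure Wz)).
(* Otherwise [f] would be continuous on [closure W'], making [W'] small. *)
have [x [O [clx xO nO]]] : exists x O, [/\ closure W' x, nbhs (f x) O &
    forall V, nbhs x V -> ~ (V `&` closure W' `<=` f @^-1` O)].
  apply: contrapT => h; apply: nW'.
  apply: small_sub (@subset_closure _ W') _.
  apply: small_closed; first exact: closed_closure.
  apply/within_continuousP => x O clx xO; apply: contrapT => nV; apply: h.
  by exists x, O; split => // V xV VO; apply: nV; exists V.
have [B [cB xB BO]] := closed_nbhs_sub xO.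
have [irr|/existsNP[V /not_implyP[xV /contrapT sV]]] :=
    pselect (irreducible W' x B); first by exists x, B.
have [x' [[x'V clx'] nOx']] : exists x', (V° `&` closure W') x' /\ ~ O (f x').
  apply: contrapT => h; apply: (nO V°); first exact: nbhs_interior.
  by move=> z Vz; apply: contrapT => nOz; apply: h; exists z.
have [B' [cB' xB' B'B]] : exists B', [/\ closed B', nbhs (f x') B' &
    B' `<=` ~` B].
  apply: closed_nbhs_sub; apply: open_nbhs_nbhs; split; last by move=> /BO.
  exact: closed_openC.
exists x', B'; split => // V' xV' sV'.
apply: (kerW' x' (V' `&` V°)) => //.
  by apply: filterI => //; exact: open_nbhs_nbhs (conj (open_interior V) x'V).
apply: (small_sub _ (smallU sV sV')) => z [[V'z /interior_subset Vz] Wz].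
have [Bz|nBz] := pselect (B (f z)); last by left.
by right; split => // /B'B.
Qed.

(* Obstacles are disjoint, so a given point can lose irreducibility to at most
   one of two successive candidates. *)
Lemma exists_extension_keeping (u : nat -> node) (n : nat) (W : set X)
    (A : set Y) (s : seq nat) :
  closed A -> W `<=` Xs s -> ~ small (W `\` f @^-1` A) ->
  (forall i, (i < n)%N -> irreducible (domain (u i)) (apex (u i)) A) ->
  exists2 v, extension_of W A s v &
    forall i, (i < n)%N ->
      irreducible (domain (u i)) (apex (u i)) (A `|` obstacle v).
Proof.
elim: n W A => [|n IH] W A cA WXs nW irrA.
  by have [v ev] := exists_extension cA WXs nW; exists v.
have [|v ev irrv] := IH W A cA WXs nW.
  by move=> i ltin; apply: irrA; rewrite ltnS ltnW.
set B := obstacle v.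
have [irrn|/existsNP[V /not_implyP[xV /contrapT sV]]] :=
    pselect (irreducible (domain (u n)) (apex (u n)) (A `|` B)).
  exists v => // i; rewrite ltnS leq_eqVlt => /orP[/eqP->//|].
  exact: irrv.
(* The second candidate is sought inside the domain of [v], with [B] added to the obstacles to
   avoid. *)
have [||||v' ev' irrv'] := IH (domain v) (A `|` B).
- by apply: closedU => //; exact: ext_closed ev.
- by apply: subset_trans WXs; exact: ext_domain ev.
- move=> sD; apply: (ext_irreducible ev (@filterT _ _ _)).
  by rewrite setTI.
- exact: irrv.
exists v'.
  split.
  - exact: subset_trans (ext_domain ev') (ext_domain ev).
  - exact: ext_code ev'.
  - exact: ext_Souslin ev'.
  - exact: ext_closed ev'.
  - exact: ext_nbhs ev'.
  - by move=> y /(ext_disjoint ev') nAB Ay; apply: nAB; left.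
  - by move=> x /(ext_avoid ev') nAB Ax; apply: nAB; left.
  - apply: irreducible_sub (ext_irreducible ev').
    by move=> y [Ay|By]; [left; left|right].
move=> i; rewrite ltnS leq_eqVlt => /orP[/eqP->|ltin]; last first.
  apply: irreducible_sub (irrv' i ltin).
  by move=> y [Ay|By]; [left; left|right].
move=> V' xV' sV'; apply: (irrA n (leqnn _) (V `&` V')); first exact: filterI.
apply: (small_sub _ (smallU sV sV')) => z [[[Vz V'z] Dz] nAz].
have [Bz|nBz] := pselect (B (f z)).
  right; split => // -[//|/(ext_disjoint ev')]; apply; by right.
by left; split => // -[].
Qed.

End irreducible.

(** * Recursive construction of the nodes *)

Lemma exists_recursive_sequence (T : Type) (t0 : T)
    (P : nat -> (nat -> T) -> Prop) :
  (forall n g h, (forall i, (i <= n)%N -> g i = h i) -> P n g -> P n h) ->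
  (forall n g, (forall m, (m < n)%N -> P m g) ->
    exists v, P n (fun i => if i == n then v else g i)) ->
  exists g, forall n, P n g.
Proof.
move=> Pext Pstep.
have /choice[F FP] (ng : nat * (nat -> T)) : exists v,
    (forall m, (m < ng.1)%N -> P m ng.2) ->
    P ng.1 (fun i => if i == ng.1 then v else ng.2 i).
  have [h|h] := pselect (forall m, (m < ng.1)%N -> P m ng.2).
    by have [v Pv] := Pstep _ _ h; exists v.
  by exists t0.
(* [G n] holds the first [n] values and is [t0] beyond; the final sequence is the diagonal
   [G i.+1 i]. *)
pose G := nat_rect (fun=> nat -> T) (fun=> t0)
  (fun n Gn i => if i == n then F (n, Gn) else Gn i).
have GE n i : (i < n)%N -> G n i = G i.+1 i.
  elim: n => // n IH; rewrite ltnS leq_eqVlt => /orP[/eqP->//|ltin].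
  by rewrite -IH //= (ltn_eqF ltin).
exists (fun i => G i.+1 i); elim/ltn_ind => n IH.
apply: (Pext _ (G n.+1)); first by move=> i lein; rewrite GE.
apply: (FP (n, G n)) => m /= ltmn; apply: Pext (IH m ltmn) => i leim.
by rewrite GE // (leq_ltn_trans leim).
Qed.

(** The factor [3 ^ N] makes the number large without changing its 2-adic valuation. *)
Lemma logn2_recurrent (a N : nat) : exists2 n, (N <= n)%N & logn 2 n.+1 = a.
Proof.
have pos : (0 < 2 ^ a * 3 ^ N)%N by rewrite muln_gt0 !expn_gt0.
exists (2 ^ a * 3 ^ N).-1.
  rewrite -ltnS prednK // (leq_trans (ltn_expl N (isT : (1 < 3)%N))) //.
  by rewrite leq_pmull // expn_gt0.
by rewrite prednK // lognM ?expn_gt0 // !lognX muln1 muln0 addn0.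
Qed.

Section construction.
Context (R : realType) (X Y : metricType R) (f : X -> Y).
Hypothesis Df : Delta02_function f.
Hypothesis nf : ~ sigma_continuous_on f setT.
Variable Xs : seq nat -> set X.
Hypothesis Xs0 : Xs [::] = setT.
Hypothesis XsS : forall s, Xs s `<=` \bigcup_k Xs (rcons s k).

Definition obstacles (n : nat) (g : nat -> node X Y) : set Y :=
  \bigcup_(i in `I_n) obstacle (g i).

(* Node [m.+1] is attached to node [logn 2 m.+1 <= m], so that every node gets
   infinitely many successors, at distances tending to [0]. *)
Definition parent_domain (n : nat) (g : nat -> node X Y) : set X :=
  if n is m.+1 then
    let u := g (logn 2 n) in domain u `&` ball (apex u) (m.+1%:R^-1 : R)
  else setT.

Definition parent_code (n : nat) (g : nat -> node X Y) : seq nat :=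
  if n is m.+1 then code (g (logn 2 n)) else [::].

Lemma exists_node_sequence : exists g : nat -> node X Y, forall n,
  extension_of f Xs (parent_domain n g) (obstacles n g) (parent_code n g) (g n).
Proof.
have [x0 _] : [set: X] !=set0.
  apply: contrapT => h; apply: nf; apply: small_sub (small0 f) => x _.
  by apply: h; exists x.
(* The second conjunct keeps every node built so far usable as a parent at the next stage. *)
pose P n g :=
  extension_of f Xs (parent_domain n g) (obstacles n g) (parent_code n g)
    (g n) /\
  forall i, (i <= n)%N ->
    irreducible f (domain (g i)) (apex (g i)) (obstacles n.+1 g).
suff [g gP] : exists g, forall n, P n g by exists g => n; have [] := gP n.
have lt_log n : (logn 2 n.+1 <= n)%N by rewrite -ltnS ltn_logl.
have eq_par n (g h : nat -> node X Y) : (forall i, (i < n)%N -> g i = h i) ->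
    [/\ parent_domain n g = parent_domain n h,
        parent_code n g = parent_code n h & obstacles n g = obstacles n h].
  move=> gh; split; last by apply: eq_bigcupr => i /= /gh ->.
    by case: n gh => //= n gh; rewrite gh // ltnS.
  by case: n gh => //= n gh; rewrite gh // ltnS.
apply: (exists_recursive_sequence (Node x0 setT [::] set0)).
  move=> n g h gh [eg ig].
  have [|pd pc ob] := eq_par n g h; first by move=> i /ltnW /gh.
  have [|_ _ obS] := eq_par n.+1 g h; first by move=> i; rewrite ltnS => /gh.
  split=> [|i lein]; first by rewrite -pd -pc -ob -gh.
  by rewrite -obS -gh //; exact: ig.
move=> n g Pg.
have cob : closed (obstacles n g).
  apply: closed_bigcup => [|i /= /Pg[eg _]]; first exact: cardinality.finite_II.
  exact: ext_closed eg.
have irr i : (i < n)%N ->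
    irreducible f (domain (g i)) (apex (g i)) (obstacles n g).
  by case: n Pg {cob} => // n Pg ltin; have [_] := Pg n (leqnn _); apply.
have sub : parent_domain n g `<=` Xs (parent_code n g).
  case: n Pg {cob irr} => [|n] Pg; first by rewrite /= Xs0.
  have [eg _] := Pg (logn 2 n.+1) (lt_log n).
  by move=> x [/(ext_Souslin eg)].
(* At the root this is [nf]; later it is irreducibility of the parent, tested on the ball in
   [parent_domain]. *)
have nsm :
    ~ sigma_continuous_on f (parent_domain n g `\` f @^-1` obstacles n g).
  case: n Pg {cob sub} irr => [|n] Pg irr.
    rewrite /= /obstacles II0 bigcup_set0 preimage_set0 setD0; exact: nf.
  rewrite /= (setIC (domain _)); apply: (irr (logn 2 n.+1)).
    exact: lt_log.
  by apply: nbhsx_ballx; rewrite invr_gt0 ltr0Sn.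
have [v ev irrv] := exists_extension_keeping Df XsS cob sub nsm irr.
exists v; set h := fun i => _.
have hE i : (i < n)%N -> g i = h i by move=> ltin; rewrite /h (ltn_eqF ltin).
have [pd pc ob] := eq_par n g h hE.
have hn : h n = v by rewrite /h eqxx.
have obS : obstacles n.+1 h = obstacles n g `|` obstacle v.
  by rewrite /obstacles IIS bigcup_setU bigcup_set1 hn -/(obstacles n h) -ob.
split; first by rewrite -pd -pc -ob hn.
move=> i; rewrite leq_eqVlt obS => /orP[/eqP->|ltin].
  by rewrite hn; exact: ext_irreducible ev.
by rewrite -hE //; exact: irrv.
Qed.

End construction.

(** * Souslin schemes and closures *)

Section Souslin_scheme.
Context (X Z : topologicalType) (i : X -> Z) (F : seq nat -> set Z).

(** Asking for a whole witness [b] through [s], not just membership in [F s], lets the pieces at the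
    successors of [s] cover the piece at [s]. *)
Definition Souslin_piece (s : seq nat) : set X :=
  [set x | exists2 b : nat -> nat, mkseq b (size s) = s &
           forall n, F (mkseq b n) (i x)].

Lemma Souslin_pieceS s :
  Souslin_piece s `<=` \bigcup_k Souslin_piece (rcons s k).
Proof.
move=> x [b bs Fb]; exists (b (size s)) => //; exists b => //.
by rewrite size_rcons mkseqS bs.
Qed.

Lemma Souslin_piece_mkseq b m n :
  (m <= n)%N -> Souslin_piece (mkseq b n) `<=` i @^-1` F (mkseq b m).
Proof.
move=> mn x [c cb /(_ m)]; rewrite size_mkseq in cb.
suff -> : mkseq c m = mkseq b m by [].
apply/eq_in_map => k; rewrite mem_iota add0n => /andP[_ km].
have kn : (k < n)%N := leq_trans km mn.
by rewrite -(nth_mkseq 0%N c kn) cb nth_mkseq.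
Qed.

End Souslin_scheme.

Lemma isometry_closure (R : realType) (X Z : metricType R) (i : X -> Z)
    (W : set X) (x : X) :
  (forall x y, mdist (i x) (i y) = mdist x y) ->
  closure W x <-> closure (i @` W) (i x).
Proof.
move=> isoi; split => clx V /nbhs_ballP[e /= e0 eV].
  have [y [Wy xy]] := clx _ (nbhsx_ballx x _ e0).
  exists (i y); split; first by exists y.
  by apply: eV; move: xy; rewrite !ballEmdist /= isoi.
have [_ [[y Wy <-] xy]] := clx _ (nbhsx_ballx (i x) _ e0).
exists y; split => //; apply: eV.
by move: xy; rewrite !ballEmdist /= isoi.
Qed.

Lemma closure_ball_avoid (R : realType) (X : metricType R) (D : set X) (x : X) :
  closed D -> ~ D x ->
  exists N, forall n, (N <= n)%N -> closure (ball x (n.+1%:R^-1 : R)) `<=` ~` D.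
Proof.
move=> cD nDx.
have /nbhs_ballP[e /= e0 eD] : nbhs x (~` D).
  by apply: open_nbhs_nbhs; split => //; exact: closed_openC.
have [N Ne] := exists_natSinv_lt (divr_gt0 e0 (ltr0Sn _ 1)).
exists N => n Nn; apply: subset_trans eD.
apply: subset_trans (@subset_closure_half _ _ x e e0); apply: closureS.
by apply: le_ball; apply: le_trans (ge_natSinv R Nn) (ltW Ne).
Qed.

(** * The branch leading to a contradiction *)

Lemma Delta02_small (R : realType) (X Y : metricType R) (f : X -> Y) :
  absolute_Souslin X -> Delta02_function f -> sigma_continuous_on f setT.
Proof.
move=> [Z [i [[cZ isoi _] [F cF FE]]]] Df; apply: contrapT => nf.
pose Xs := Souslin_piece i F.
have Xs0 : Xs [::] = setT.
  rewrite -subTset => x _.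
  have : range i (i x) by exists x.
  by rewrite FE => -[b _ Fb]; exists b => // n; exact: Fb.
have [g gP] := exists_node_sequence Df nf Xs0 (@Souslin_pieceS _ _ i F).
pose U := \bigcup_n (obstacle (g n))°.
have cl_apex n : closure (domain (g n)) (apex (g n)).
  exact: irreducible_closure (ext_irreducible (gP n)).
have [D cD DE] : Fsigma (f @^-1` (~` U)).
  apply: Df; apply: closed_Fsigma; apply: open_closedC.
  by apply: bigcup_open => n _; exact: open_interior.
have nD j n : ~ D j (apex (g n)).
  move=> Dn; have : (\bigcup_j D j) (apex (g n)) by exists j.
  by rewrite -DE; apply; exists n => //; exact: ext_nbhs (gP n).
(* Node [n.+1] will be a child of node [ja.2] whose ball avoids [D ja.1]; the bound [ja.1 <= n]
   makes the radii along a branch tend to 0. *)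
have /choice[next nextP] (ja : nat * nat) : exists n,
    [/\ (ja.1 <= n)%N, logn 2 n.+1 = ja.2 &
      closure (ball (apex (g ja.2)) (n.+1%:R^-1 : R)) `<=` ~` D ja.1].
  have [N NP] := closure_ball_avoid (cD ja.1) (nD ja.1 ja.2).
  have [n le_n na] := logn2_recurrent ja.2 (maxn ja.1 N).
  exists n; split => //; first exact: leq_trans (leq_maxl _ _) le_n.
  by apply: NP; exact: leq_trans (leq_maxr _ _) le_n.
(* The branch starts at the root [0]; the shift by one reflects that node [n.+1] hangs below
   [logn 2 n.+1]. *)
pose k := nat_rect (fun=> nat) 0%N (fun j a => (next (j, a)).+1).
pose w j := g (k j).
have kS j : k j.+1 = (next (j, k j)).+1 by [].
have le_k j : (j <= next (j, k j))%N by have [] := nextP (j, k j).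
have wS j : domain (w j.+1) `<=`
    domain (w j) `&` ball (apex (w j)) ((next (j, k j)).+1%:R^-1 : R).
  rewrite /w kS => x /(ext_domain (gP _)) /=.
  by have [_ /= -> _] := nextP (j, k j).
have w_mono j m : (j <= m)%N -> domain (w m) `<=` domain (w j).
  move=> /subnK <-; elim: (m - j)%N => // d IH x.
  by rewrite addSn => /wS[/IH].
have cvg_in (G : set Z) (z : Z) j : closed G ->
    (fun m => i (apex (w m))) @ \oo --> z ->
    i @` domain (w j) `<=` G -> G z.
  move=> cG wz jG; apply: closed_cvg wz => //; exists j => // m /= jm.
  apply: cG; apply: (closureS jG).
  apply: (closureS (image_subset i (w_mono _ _ jm))).
  exact/(isometry_closure _ _ isoi)/cl_apex.
have [z wz] : exists z : Z, (fun m => i (apex (w m))) @ \oo --> z.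
  apply: (cZ (_ @ \oo) _); apply: cauchy_exP => e /= e0.
  have [N Ne] := exists_natSinv_lt (divr_gt0 e0 (ltr0Sn _ 1)).
  exists (i (apex (w N))); exists N.+1 => // m /= Nm.
  rewrite ballEmdist /= isoi.
  have : ball (apex (w N)) e (apex (w m)).
    apply: (@subset_closure_half _ _ _ _ e0).
    apply: closureS (cl_apex (k m)) => x /(w_mono _ _ Nm) /wS[_].
    by apply: le_ball; apply: le_trans (ge_natSinv R (le_k N)) (ltW Ne).
  by rewrite ballEmdist.
(* The root's code has length 1 and each step appends one entry, so [b j] is the last entry of
   [code (w j)]. *)
pose b j := nth 0%N (code (w j)) j.
have codeE j : code (w j) = mkseq b j.+1.
  elim: j => [|j IH].
    by have [a a0] := ext_code (gP 0%N); rewrite /b /mkseq /= /w /= a0.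
  have [a] := ext_code (gP (k j.+1)); rewrite -/(w j.+1) kS /=.
  have [_ /= -> _] := nextP (j, k j); rewrite -/(w j) => wa.
  have sz : size (code (w j)) = j.+1 by rewrite IH size_mkseq.
  by rewrite mkseqS -IH /b wa nth_rcons sz ltnn eqxx.
have [x _ xz] : range i z.
  rewrite FE; exists b => // n _; apply: (cvg_in _ _ n) => //.
  move=> _ [y /(ext_Souslin (gP (k n))) + <-].
  by rewrite -/(w n) codeE; exact: Souslin_piece_mkseq.
have clx j : closure (domain (w j)) x.
  apply/(isometry_closure _ _ isoi); rewrite xz.
  by apply: (cvg_in _ _ j) => //; [exact: closed_closure|exact: subset_closure].
have : (f @^-1` (~` U)) x.
  (* Since [n < k n.+1], obstacle [n] is among those avoided by the closure of [domain (w n.+1)]. *)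
  move=> [n _ /interior_subset On].
  apply: (ext_avoid (gP (k n.+1)) (clx n.+1)).
  by exists n => //=; rewrite ltnS.
rewrite DE => -[j _ Dj].
have [_ _ /= nDj] := nextP (j, k j).
apply: (nDj x) Dj; apply: closureS (clx j.+1) => y.
by move=> /wS[].
Qed.

Theorem theorem1p3 (R : realType) (X Y : metricType R)
    (hX : absolute_Souslin X) (f : X -> Y) :
  Delta02_function f <-> piecewise_continuous f.
Proof.
split; last exact: piecewise_continuous_Delta02.
by move=> Df; apply/piecewise_continuous_small/Delta02_small.
Qed.
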